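(* Call a finite union-closed family $\mathcal{F}$ of sets an $(f,k,n)$-construction if there are precisely $f$ elements each of which belongs to more than half of the sets of $\mathcal{F}$, and $k$ and $n$ are the sizes of a smallest set and of the largest set of $\mathcal{F}$, respectively. Then: \begin{enumerate} \item There exist a $(2,3,8)$-construction, a $(3,4,9)$-construction, a $(4,5,9)$-construction and a $(5,6,10)$-construction, each of which is twin-free. \item There is a twin-free $(2,k,n)$-construction for all integers $k,n$ satisfying $$\sum_{i=k-1}^{\lfloor n/2\rfloor-1}\binom{\lfloor n/2\rfloor-1}{i} > \binom{n-3}{k-3}+\binom{\lfloor n/2\rfloor-2}{k-2};$$ moreover, for every $k$ this inequality holds for all sufficiently large $n$. \item There is a $(2,k,n)$-construction for all nonnegative integers $k,n$ with $n\geq\max\{3,5k-4\}$; furthermore, if $k$ is even, $n\geq\max\{3,5k-8\}$ suffices. \item There is a $(k-1,k,n)$-construction for all integers $k,n$ satisfying $n-4\geq k\geq 3$ and $n\geq 9$. \end{enumerate}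
   Context: A family of sets is a collection of pairwise distinct sets; it is union-closed if the union of any two of its sets belongs to it. Two elements $a,b$ are twins in a family $\mathcal{F}$ if every set $A\in\mathcal{F}$ satisfies $|A\cap\{a,b\}|\neq 1$; $\mathcal{F}$ is twin-free if it has no pair of twins.
   Formalization: In item 2, k and n are taken nonnegative in the existence claim and the pair (k,n)=(0,2) is excluded: with binomials of negative arguments equal to 0 the inequality holds there and for some negative k, but no such construction exists. *)

(* Defs.v *)
(* MathComp *)
From mathcomp Require Import all_boot all_order all_algebra.

Set Implicit Arguments.
Unset Strict Implicit.
Unset Printing Implicit Defensive.

Local Open Scope nat_scope.

Section Families.

Variable T : finType.
Implicit Types (F : {set {set T}}) (a b x : T).

Definition union_closed F : Prop :=
  forall A B, A \in F -> B \in F -> A :|: B \in F.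

Definition degree F x : nat := #|[set A in F | x \in A]|.

Definition frequent F : {set T} := [set x | #|F| < 2 * degree F x].

Definition smallest_size F (k : nat) : Prop :=
  (exists2 A, A \in F & #|A| = k) /\ (forall A, A \in F -> k <= #|A|).

Definition largest_size F (n : nat) : Prop :=
  (exists2 A, A \in F & #|A| = n) /\ (forall A, A \in F -> #|A| <= n).

(* The last two conditions force F to be nonempty.  The type T may be larger
   than the union of F: a frequent element lies in this union anyway. *)
Definition construction f k n F : Prop :=
  [/\ union_closed F, #|frequent F| = f, smallest_size F k & largest_size F n].

Definition twins F a b : Prop :=
  a != b /\ forall A, A \in F -> #|A :&: [set a; b]| <> 1.

(* The elements of a family are those of its union; points of T outside the
   union are not elements of F, hence are never counted as twins. *)
Definition twin_free F : Prop :=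
  forall a b, a \in cover F -> b \in cover F -> ~ twins F a b.

End Families.

(* Binomial coefficient with integer arguments, equal to 0 as soon as one of
   them is negative. *)
Definition binz (a b : int) : nat :=
  match a, b with
  | Posz a', Posz b' => 'C(a', b')
  | _, _ => 0
  end.

(* The sum of F i over the integers a <= i <= b, empty if b < a. *)
Definition sumz (a b : int) (F : int -> nat) : nat :=
  if (a <= b)%R then \sum_(0 <= j < `|b - a|.+1) F (a + j%:Z)%R else 0.

(* The subtractions are those of int: for k <= 2 the lower index k - 3 is
   negative, and truncating it to 0 would change the inequality. *)
Definition binomial_condition (k n : int) : Prop :=
  let h : int := (n %/ 2)%Z in
  binz (n - 3)%R (k - 3)%R + binz (h - 2)%R (k - 2)%R
    < sumz (k - 1)%R (h - 1)%R (fun i => binz (h - 1)%R i).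

(* Main.v *)
(* Take two distinguished elements a, b and two disjoint blocks X, Y of size
   h - 1, where h = n %/ 2.  Let F consist of the sets of size at least k that
   contain a and b, or that have the form a + S with S inside X, or b + S with
   S inside Y.  For x outside Y, removing x from the sets containing x is an
   injection into the sets avoiding x, up to C(n-3, k-3) + C(h-2, k-2) sets that
   become too small; its image misses all the sets b + S, so the binomial
   inequality makes x infrequent, while a and b are frequent.  This gives the
   twin-free (2, k, n)-constructions, in particular (2, 3, 8) and (2, 4, 12).

   Replacing the ten infrequent elements of the (2, 4, 12)-construction by m
   copies each gives (2, 2m + 2, 10m + 2), hence the linear bounds in (3).  For
   (4), start from (2, 3, 8) or from an explicit (4, 5, 9)-construction; adding
   a common element to all sets raises f, k and n by 1, and duplicating an
   infrequent element that some smallest set avoids raises only n. *)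
Require Import Defs.
From mathcomp Require Import all_boot all_order all_algebra.
From mathcomp Require Import zify.

Set Implicit Arguments.
Unset Strict Implicit.
Unset Printing Implicit Defensive.

Local Open Scope nat_scope.

(** * Frequency and twins *)

Section Generalities.

Variables (T : finType) (F : {set {set T}}).

(** In this form, frequency is decided by an injection between the sets containing x and those
    avoiding it. *)
Lemma in_frequent x :
  (x \in frequent F) = (#|[set A in F | x \notin A]| < degree F x).
Proof.
rewrite inE mul2n -addnn -(cardsID [set A : {set T} | x \in A] F).
have -> : F :&: [set A : {set T} | x \in A] = [set A in F | x \in A].
  by apply/setP=> A; rewrite !inE.
have -> : F :\: [set A : {set T} | x \in A] = [set A in F | x \notin A].
  by apply/setP=> A; rewrite !inE andbC.
by rewrite ltn_add2l.
Qed.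

Lemma largest_size_setT : setT \in F -> largest_size F #|T|.
Proof.
by move=> FT; split=> [|A _]; [exists setT; rewrite ?cardsT | apply: max_card].
Qed.

Lemma universal_frequent x :
  setT \in F -> (forall A, A \in F -> x \in A) -> x \in frequent F.
Proof.
move=> FT xF; rewrite in_frequent.
have -> : [set A in F | x \notin A] = set0.
  by apply/setP=> A; rewrite !inE; apply/negbTE/negP=> /andP[/xF ->].
by rewrite cards0 card_gt0; apply/set0Pn; exists setT; rewrite !inE FT.
Qed.

Lemma twin_free_sep :
  (forall a b, a != b -> exists2 A, A \in F & (a \in A) != (b \in A)) ->
  twin_free F.
Proof.
move=> sep a b _ _ [/sep[A FA]]; wlog aA : a b / a \in A => [hw dab tw|].
  case/boolP: (a \in A) => aA; first exact: (hw a b).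
  have bA: b \in A by move: dab; rewrite (negbTE aA); case: (b \in A).
  by apply: (hw b a) => //; rewrite ?(eq_sym (b \in A)) 1?setUC.
rewrite aA => bA /(_ A FA); case; have {}bA: b \notin A by case: (b \in A) bA.
rewrite -(cards1 a); congr #|pred_of_set _|; apply/setP=> x; rewrite !inE.
case: eqVneq => [->|_] /=; first by rewrite aA.
by case: eqVneq => [->|_]; rewrite ?andbF // (negbTE bA).
Qed.

End Generalities.

(* The first condition makes the family obtained by adding a common element to
   all sets twin-free as well. *)
Definition separating (T : finType) (F : {set {set T}}) : Prop :=
  (forall x, exists2 A, A \in F & x \notin A) /\
  (forall x y, x != y -> exists2 A, A \in F & (x \in A) != (y \in A)).

(** * Adding a common element to all sets *)

Section Universal.

Variables (T : finType) (F : {set {set T}}).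

Definition adjoin (A : {set T}) : {set option T} := None |: Some @: A.
Definition adjoin_family : {set {set option T}} := adjoin @: F.

Lemma in_adjoin A x : (x \in adjoin A) = (if x is Some y then y \in A else true).
Proof.
by case: x => [y|]; rewrite !inE //= mem_imset //; apply: Some_inj.
Qed.

Lemma adjoin_inj : injective adjoin.
Proof.
by move=> A B AB; apply/setP=> x; rewrite -!(in_adjoin _ (Some x)) AB.
Qed.

Lemma card_adjoin A : #|adjoin A| = #|A|.+1.
Proof.
rewrite cardsU1 card_imset; last exact: Some_inj.
by case: imsetP => // [[]].
Qed.

Lemma adjoin_union_closed : union_closed F -> union_closed adjoin_family.
Proof.
move=> UF _ _ /imsetP[A FA ->] /imsetP[B FB ->].
apply/imsetP; exists (A :|: B); first exact: UF.
by apply/setP=> x; rewrite inE !in_adjoin; case: x => // y; rewrite inE.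
Qed.

Lemma adjoin_setT : setT \in F -> setT \in adjoin_family.
Proof.
move=> FT; apply/imsetP; exists setT => //.
by apply/setP=> x; rewrite in_adjoin; case: x => [y|]; rewrite !inE.
Qed.

Lemma frequent_adjoin :
  setT \in F -> frequent adjoin_family = adjoin (frequent F).
Proof.
move=> FT; apply/setP=> x; rewrite in_adjoin; case: x => [y|].
  rewrite !inE card_imset; last exact: adjoin_inj.
  congr (_ < 2 * _); rewrite /degree.
  have -> : [set B in adjoin_family | Some y \in B]
            = adjoin @: [set A in F | y \in A].
    apply/setP=> B; rewrite !inE.
    apply/andP/imsetP=> [[/imsetP[A FA ->]]|[A]].
      by rewrite in_adjoin => yA; exists A; rewrite // inE FA.
    by rewrite inE => /andP[FA yA] ->; rewrite in_adjoin imset_f.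
  exact/card_imset/adjoin_inj.
apply: universal_frequent; first exact: adjoin_setT.
by move=> _ /imsetP[A _ ->]; rewrite in_adjoin.
Qed.

Lemma adjoin_construction f k n :
  setT \in F -> construction f k n F ->
  construction f.+1 k.+1 n.+1 adjoin_family.
Proof.
move=> FT [UF cf [[A FA cA] minF] [[B FB cB] maxF]]; split.
- exact: adjoin_union_closed.
- by rewrite frequent_adjoin // card_adjoin cf.
- split; first by exists (adjoin A); rewrite ?imset_f // card_adjoin cA.
  by move=> _ /imsetP[C FC ->]; rewrite card_adjoin ltnS minF.
- split; first by exists (adjoin B); rewrite ?imset_f // card_adjoin cB.
  by move=> _ /imsetP[C FC ->]; rewrite card_adjoin ltnS maxF.
Qed.

Lemma adjoin_twin_free : separating F -> twin_free adjoin_family.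
Proof.
case=> miss sep; apply: twin_free_sep => -[a|] [b|] // ab.
- by have [A FA dA] := sep a b ab; exists (adjoin A); rewrite ?imset_f ?in_adjoin.
- have [A FA /negbTE aA] := miss a.
  by exists (adjoin A); rewrite ?imset_f ?in_adjoin // aA.
- have [A FA /negbTE bA] := miss b.
  by exists (adjoin A); rewrite ?imset_f ?in_adjoin // bA.
Qed.

End Universal.

(** * Replacing elements by copies *)

Section Inflation.

Variables (T : finType) (F : {set {set T}}) (w : T -> nat).

(** A point of the new ground set is an element x with a copy number below [w x], so sizes become
    weighted sums. *)
Definition inflate (A : {set T}) : {set {x : T & 'I_(w x)}} :=
  [set u | tag u \in A].
Definition inflate_family := inflate @: F.

Lemma card_inflate A : #|inflate A| = \sum_(x in A) w x.
Proof.
rewrite -sum1_card; under eq_bigl do rewrite inE.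
rewrite [RHS](eq_bigr (fun x => \sum_(j < w x) 1)); last first.
  by move=> x _; rewrite sum1_card card_ord.
by rewrite sig_big_dep /=; apply: eq_bigl => u; rewrite andbT.
Qed.

(* Elements may be deleted (weight 0) only if they lie in every set. *)
Hypothesis w0 : forall x, w x = 0 -> forall A, A \in F -> x \in A.

(** Membership of x is read off at its copy 0 if the weight is positive; otherwise [w0] puts x in
    both sets. *)
Lemma inflate_inj : {in F &, injective inflate}.
Proof.
move=> A B FA FB AB; apply/setP=> x.
case Dw: (w x) => [|m]; first by rewrite !w0.
have lt0: 0 < w x by rewrite Dw.
by have /setP/(_ (Tagged _ (Ordinal lt0))) := AB; rewrite !inE.
Qed.

Lemma inflate_frequent : frequent inflate_family = inflate (frequent F).
Proof.
apply/setP=> u; rewrite !inE (card_in_imset inflate_inj).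
congr (_ < 2 * _); rewrite /degree.
have -> : [set B in inflate_family | u \in B]
          = inflate @: [set A in F | tag u \in A].
  apply/setP=> B; rewrite !inE.
  apply/andP/imsetP=> [[/imsetP[A FA ->]]|[A]].
    by rewrite inE => yA; exists A; rewrite // inE FA.
  by rewrite inE => /andP[FA yA] ->; rewrite inE imset_f.
by apply: card_in_imset; apply: sub_in2 inflate_inj => A; rewrite inE => /andP[].
Qed.

Lemma inflate_construction f k n :
  union_closed F -> setT \in F ->
  \sum_(x in frequent F) w x = f ->
  (exists2 A, A \in F & \sum_(x in A) w x = k) ->
  (forall A, A \in F -> k <= \sum_(x in A) w x) ->
  \sum_x w x = n ->
  construction f k n inflate_family.
Proof.
move=> UF FT cf [A FA cA] minF sn; split.
- move=> _ _ /imsetP[B FB ->] /imsetP[C FC ->].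
  apply/imsetP; exists (B :|: C); first exact: UF.
  by apply/setP=> u; rewrite !inE.
- by rewrite inflate_frequent card_inflate.
- split; first by exists (inflate A); rewrite ?imset_f // card_inflate.
  by move=> _ /imsetP[C FC ->]; rewrite card_inflate minF.
- split.
    exists (inflate setT); rewrite ?imset_f // card_inflate -sn.
    by apply: eq_bigl => x; rewrite inE.
  move=> _ /imsetP[C FC ->]; rewrite card_inflate -sn.
  by rewrite [leqRHS](bigID (mem C)) leq_addr.
Qed.

End Inflation.

(** * Explicit families as lists of bit vectors *)

Section BitVectors.

Variable n : nat.
Implicit Types (s t : seq bool) (L : seq (seq bool)).

(** The encoding reduces closure, degrees and sizes of an explicit family to boolean computations on
    lists. *)
Definition set_of_bits s : {set 'I_n} := [set i : 'I_n | nth false s i].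
Definition bits_family L : {set {set 'I_n}} := [set A in map set_of_bits L].
Definition or_bits s t : seq bool := [seq p.1 || p.2 | p <- zip s t].
Definition bit_degree L (i : nat) : nat := count (fun s => nth false s i) L.

Definition bits_union_closed L : bool :=
  [&& uniq L, all (fun s => size s == n) L
    & all (fun s => all (fun t => or_bits s t \in L) L) L].

Lemma set_of_bits_inj L :
  all (fun s => size s == n) L -> {in L &, injective set_of_bits}.
Proof.
move=> /allP szL s t /szL/eqP szs /szL/eqP szt st.
apply: (@eq_from_nth _ false) => [|i]; first by rewrite szs szt.
rewrite szs => lt_i; have /setP/(_ (Ordinal lt_i)) := st.
by rewrite !inE.
Qed.

Lemma card_set_of_bits s : size s = n -> #|set_of_bits s| = count id s.
Proof.
move=> sz; rewrite -sum1_card -sum1_count.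
rewrite (big_nth false) sz big_mkord.
by apply: eq_bigl => i; rewrite inE.
Qed.

Lemma union_set_of_bits s t :
  size s = n -> size t = n ->
  set_of_bits (or_bits s t) = set_of_bits s :|: set_of_bits t.
Proof.
move=> szs szt; apply/setP=> i; rewrite !inE /or_bits.
rewrite (nth_map (false, false)) ?nth_zip //= ?size_zip ?szs ?szt //.
by rewrite minnn.
Qed.

Variable L : seq (seq bool).
Hypothesis LP : bits_union_closed L.

Let uniqL : uniq L. Proof. by case/and3P: LP. Qed.
Let sizeL : all (fun s => size s == n) L. Proof. by case/and3P: LP. Qed.

Lemma bits_familyP A :
  reflect (exists2 s, s \in L & A = set_of_bits s) (A \in bits_family L).
Proof. by rewrite inE; apply: mapP. Qed.

Lemma bits_familyU : union_closed (bits_family L).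
Proof.
move=> _ _ /bits_familyP[s Ls ->] /bits_familyP[t Lt ->].
have /eqP szs := allP sizeL s Ls; have /eqP szt := allP sizeL t Lt.
rewrite -union_set_of_bits //; apply/bits_familyP.
by exists (or_bits s t) => //; case/and3P: LP => _ _ /allP/(_ s Ls)/allP/(_ t Lt).
Qed.

Lemma card_bits (p : pred (seq bool)) (P : pred {set 'I_n}) :
  (forall s, P (set_of_bits s) = p s) ->
  #|[set A in bits_family L | P A]| = count p L.
Proof.
move=> Pp; rewrite -size_filter -(size_map set_of_bits).
have /card_uniqP <- : uniq (map set_of_bits (filter p L)).
  rewrite map_inj_in_uniq ?filter_uniq // => s t.
  rewrite !mem_filter => /andP[_ Ls] /andP[_ Lt].
  exact: set_of_bits_inj sizeL s t Ls Lt.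
rewrite cardsE; apply: eq_card => A.
apply/andP/mapP => [[/bits_familyP[s Ls ->] PA]|[s]].
  by exists s => //; rewrite mem_filter Ls -Pp PA.
by rewrite mem_filter -Pp => /andP[ps Ls] ->; split=> //; apply/bits_familyP; exists s.
Qed.

Lemma frequent_bits :
  frequent (bits_family L) = [set i : 'I_n | size L < 2 * bit_degree L i].
Proof.
apply/setP=> i; rewrite !inE; congr (_ < 2 * _).
  rewrite -(count_predT L) -(@card_bits predT predT) //.
  by apply: eq_card => A; rewrite !inE andbT.
by apply: card_bits => s; rewrite inE.
Qed.

Lemma bits_construction f k :
  nseq n true \in L ->
  count (fun i => size L < 2 * bit_degree L i) (iota 0 n) = f ->
  has (fun s => count id s == k) L ->
  all (fun s => k <= count id s) L ->
  setT \in bits_family L /\ construction f k n (bits_family L).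
Proof.
move=> LT cf /hasP[s Ls /eqP cs] /allP mins.
have FT: setT \in bits_family L.
  apply/bits_familyP; exists (nseq n true) => //.
  by apply/setP=> i; rewrite !inE nth_nseq ltn_ord.
split=> //; split; first exact: bits_familyU.
- rewrite frequent_bits -cf -val_enum_ord count_map -sum1_card -sum1_count.
  by rewrite big_enum_cond /=; apply: eq_bigl => i; rewrite inE.
- split=> [|_ /bits_familyP[t Lt ->]].
    exists (set_of_bits s); first by apply/bits_familyP; exists s.
    by rewrite card_set_of_bits //; apply/eqP/(allP sizeL).
  by rewrite card_set_of_bits ?mins //; apply/eqP/(allP sizeL).
- by rewrite -[n in largest_size _ n]card_ord; apply: largest_size_setT.
Qed.

Lemma bits_separating :
  all (fun i => has (fun s => ~~ nth false s i) L &&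
    all (fun j => (i == j) || has (fun s => nth false s i != nth false s j) L)
      (iota 0 n)) (iota 0 n) ->
  separating (bits_family L).
Proof.
move=> /allP sep; have In (i : 'I_n) : val i \in iota 0 n by rewrite mem_iota /=.
split=> [i|i j ij]; have /andP[/hasP[s Ls si] /allP dist] := sep _ (In i).
  by exists (set_of_bits s); [apply/bits_familyP; exists s | rewrite inE].
have := dist _ (In j); rewrite val_eqE (negbTE ij) => /hasP[t Lt tij].
by exists (set_of_bits t); [apply/bits_familyP; exists t | rewrite !inE].
Qed.

End BitVectors.

(* The elements 0,..,3 are frequent; every A with [A :&: {0,..,3}] missing i is
   {0,..,3} minus i plus one of the sets listed in row i. *)
Definition rows459 : seq (seq (seq nat)) :=
  [:: [:: [:: 5; 7]; [:: 5; 8]; [:: 5; 7; 8]];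
      [:: [:: 6; 7]; [:: 6; 8]; [:: 6; 7; 8]];
      [:: [:: 4; 7]; [:: 4; 8]; [:: 4; 7; 8]];
      [:: [:: 4; 5]; [:: 4; 6]; [:: 5; 6]; [:: 4; 5; 6]]].

(** There are 31 proper supersets of {0,..,3} and 13 sets from the rows; each of 4,..,8 lies in
    exactly 22 of these 44 sets, hence is not frequent. *)
Definition bits459 : seq (seq bool) :=
  [seq nseq 4 true ++ t
     | t <- iter 5 (allpairs cons [:: true; false]) [:: [::]] & has id t] ++
  [seq mkseq (mem (rem i (iota 0 4) ++ s)) 9
     | i <- iota 0 4, s <- nth [::] rows459 i].
(** A (2, 2, 3)-construction; two blocks give minimum size 2 only from n = 4 on. *)
Definition bits23 : seq (seq bool) := [:: [:: true; true; false]; nseq 3 true].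

Lemma construction459 :
  let F := bits_family 9 bits459 in setT \in F /\ construction 4 5 9 F.
Proof. by apply: bits_construction; vm_compute. Qed.

(** * Counting sets in an interval *)

Section Between.

Variable T : finType.
Implicit Types (P Q A : {set T}).

(** Taking the union with P is a bijection from the m-subsets of Q minus P. *)
Lemma card_between P Q m :
  P \subset Q ->
  #|[set A : {set T} | [&& P \subset A, A \subset Q & #|A| == #|P| + m]]|
    = 'C(#|Q| - #|P|, m).
Proof.
move=> PQ; have -> : #|Q| - #|P| = #|Q :\: P|.
  by rewrite cardsD (setIidPr PQ).
have -> : [set A : {set T} | [&& P \subset A, A \subset Q & #|A| == #|P| + m]]
          = setU P @: [set B : {set T} | B \subset Q :\: P & #|B| == m].
  apply/setP=> A; rewrite inE; apply/and3P/imsetP => [[PA AQ /eqP cA]|[B]].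
    exists (A :\: P); last by rewrite setDE setUIr setUCr setIT (setUidPr PA).
    by rewrite inE setSD //= cardsD (setIidPr PA) cA addKn.
  rewrite inE subsetD => /andP[/andP[BQ dB] /eqP cB] ->.
  rewrite subsetUl subUset PQ BQ; split=> //.
  by rewrite cardsU disjoint_setI0 1?disjoint_sym // cards0 subn0 cB.
rewrite card_in_imset ?cards_draws // => A B; rewrite !inE !subsetD.
move=> /andP[/andP[_ dA] _] /andP[/andP[_ dB] _] AB; apply/setP=> x.
have /setP/(_ x) := disjoint_setI0 dA; have /setP/(_ x) := disjoint_setI0 dB.
have /setP/(_ x) := AB; rewrite !inE.
by case: (x \in P); rewrite ?andbT ?andbF //= => _ -> ->.
Qed.

Lemma card_below P m :
  #|[set A in powerset P | m <= #|A|]| = \sum_(m <= i < #|P|.+1) 'C(#|P|, i).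
Proof.
rewrite -sum1_card big_mkcond /= [RHS](eq_bigr (fun i =>
  \sum_(A : {set T}) ((A \subset P) && (#|A| == i) : nat))) => [|i _]; last first.
  by rewrite -cards_draws -sum1_card big_mkcond; apply: eq_bigr => A _; rewrite inE; case: ifP.
rewrite exchange_big; apply: eq_bigr => A _; rewrite !inE.
case: (boolP (A \subset P)) => AP /=; last by rewrite big1.
transitivity (nat_of_bool (#|A| \in index_iota m #|P|.+1)).
  by rewrite mem_index_iota ltnS subset_leq_card // andbT; case: ifP.
rewrite -count_uniq_mem ?iota_uniq // -sum1_count big_mkcond.
by apply: eq_bigr => i _; rewrite /= eq_sym; case: ifP.
Qed.

End Between.

(** * The two-block family and its infrequent elements *)

Section TwoBlocks.

Variable T : finType.
Implicit Types (a b c x : T) (X Y Z A : {set T}).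

Definition wing c Z A : bool := (c \in A) && (A \subset c |: Z).

(** The empty set has size at least k only for k = 0, where it is the smallest set. *)
Definition two_blocks a b X Y k : {set {set T}} :=
  [set A : {set T} | (k <= #|A|) &&
     [|| A == set0, wing a X A, wing b Y A | (a \in A) && (b \in A)]].

Lemma two_blocksC a b X Y k : two_blocks a b X Y k = two_blocks b a Y X k.
Proof.
apply/setP=> A; rewrite !inE [(a \in A) && _]andbC.
by case: (wing a X A); case: (wing b Y A).
Qed.

(** Here p is the block size h - 1. The factors [(2 < k)] and [(1 < k)] cancel the terms whose lower
    index is negative, which truncated subtraction would turn into 1. *)
Definition binomial_ineq (N p k : nat) : bool :=
  (2 < k) * 'C(N - 3, k - 3) + (1 < k) * 'C(p - 1, k - 2)
    <= \sum_(k.-1 <= i < p.+1) 'C(p, i).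

Section Infrequent.

Variables (a b x : T) (X Y : {set T}) (k : nat).
Hypotheses (ab : a != b) (aX : a \notin X) (bX : b \notin X).
Hypotheses (aY : a \notin Y) (bY : b \notin Y) (cXY : #|X| = #|Y|).
Hypotheses (xa : x != a) (xb : x != b) (xY : x \notin Y).

Local Notation F := (two_blocks a b X Y k).

(** Deleting x from a set of size k leaves one of size k - 1: [C1] collects those containing a and
    b, [C2] those in the wing at a. Writing the size as [#|B|.+1 == k] leaves both empty for k =
    0. *)
Let C1 := [set B : {set T} |
  [&& [set a; b] \subset B, B \subset ~: [set x] & #|B|.+1 == k]].
Let C2 := [set B : {set T} | (x \in X) &&
  [&& [set a] \subset B, B \subset (a |: X) :\ x & #|B|.+1 == k]].
Let D := [set B : {set T} | wing b Y B && (k <= #|B|)].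

Lemma card_C1 : #|C1| = (2 < k) * 'C(#|T| - 3, k - 3).
Proof.
have c2 : #|[set a; b]| = 2 by rewrite cards2 ab.
case: ltnP => [lt2k|lek2]; last first.
  apply: eq_card0 => B; rewrite inE; apply/and3P=> [[/subset_leq_card leB _ cB]].
  by move: leB lek2; rewrite c2 -(eqP cB); lia.
have sub : [set a; b] \subset ~: [set x].
  by rewrite subsetC sub1set !inE negb_or xa xb.
have := card_between (k - 3) sub; rewrite c2 cardsC1 mul1n.
have -> : #|T|.-1 - 2 = #|T| - 3 by lia.
move=> <-; apply: eq_card => B; rewrite !inE.
by congr [&& _, _ & _]; apply/eqP/eqP; lia.
Qed.

Lemma card_C2 : #|C2| <= (1 < k) * 'C(#|X| - 1, k - 2).
Proof.
case: ltnP => [lt1k|lek1]; last first.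
  rewrite leqn0; apply/eqP/eq_card0 => B; rewrite inE.
  apply/and4P=> [[_ /subset_leq_card leB _ cB]].
  by move: leB lek1; rewrite cards1 -(eqP cB); lia.
case: (boolP (x \in X)) => xX; last first.
  by rewrite (eq_card0 (A := C2)) // => B; rewrite inE (negbTE xX).
have sub : [set a] \subset (a |: X) :\ x.
  by rewrite sub1set !inE eqxx eq_sym xa.
have := card_between (k - 2) sub; rewrite cards1 mul1n.
have -> : #|(a |: X) :\ x| = #|X|.
  by have := cardsD1 x (a |: X); rewrite cardsU1 aX !inE xX orbT !add1n => -[].
move=> <-; rewrite leq_eqVlt; apply/orP; left; apply/eqP.
apply: eq_card => B; rewrite !inE xX /=.
by congr [&& _, _ & _]; apply/eqP/eqP; lia.
Qed.

(** Adding b, which is outside Y, maps the subsets of Y with at least k - 1 elements injectively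
    into [D]. *)
Lemma card_D : \sum_(k.-1 <= i < #|Y|.+1) 'C(#|Y|, i) <= #|D|.
Proof.
rewrite -card_below -(@card_in_imset _ _ (setU [set b])) => [|A B].
  apply: subset_leq_card; apply/subsetP=> _ /imsetP[A + ->].
  rewrite !inE => /andP[AY cA]; rewrite /wing setU11 setUS //=.
  rewrite cardsU1; case: (boolP (b \in A)) => [/(subsetP AY)|_]; last by lia.
  by rewrite (negbTE bY).
rewrite !inE => /andP[AY _] /andP[BY _] AB; apply/setP=> y.
have bA: b \notin A by apply: contra bY; apply: (subsetP AY).
have bB: b \notin B by apply: contra bY; apply: (subsetP BY).
have /setP/(_ y) := AB; rewrite !inE.
by case: eqVneq => //= ->; rewrite (negbTE bA) (negbTE bB).
Qed.

(* Removing x maps the sets containing x injectively to sets of F avoiding x,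
   except for the small sets in C1 and C2; the wing at b is never hit. *)
Lemma two_blocks_infrequent : binomial_ineq #|T| #|X| k -> x \notin frequent F.
Proof.
move=> ineq; rewrite in_frequent -leqNgt.
set F1 := [set A in F | x \in A]; set F0 := [set A in F | x \notin A].
have inj1 : {in F1 &, injective (fun A => A :\ x)}.
  move=> A B; rewrite !inE => /andP[_ xA] /andP[_ xB] AB.
  by rewrite -(setD1K xA) -(setD1K xB) AB.
have sub1 : [set A :\ x | A in F1] \subset (F0 :\: D) :|: (C1 :|: C2).
  apply/subsetP=> _ /imsetP[A + ->]; rewrite !inE => /andP[/andP[kA sA] xA].
  have cA : #|A| = #|A :\ x|.+1 by rewrite (cardsD1 x) xA.
  have aAx : (a \in A :\ x) = (a \in A) by rewrite !inE eq_sym xa.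
  have bAx : (b \in A :\ x) = (b \in A) by rewrite !inE eq_sym xb.
  rewrite /wing aAx bAx eqxx /=.
  have eqk : #|A :\ x| < k -> #|A :\ x|.+1 == k.
    by rewrite eqn_leq -cA kA andbT cA.
  case/or4P: sA => [/eqP A0|/andP[aA AX]|/andP[bA AY]|/andP[aA bA]].
  - by rewrite A0 inE in xA.
  - have bA : b \notin A.
      by apply: contra bX => /(subsetP AX); rewrite !inE eq_sym (negbTE ab).
    have xX : x \in X by have := subsetP AX x xA; rewrite !inE (negbTE xa).
    rewrite aA (negbTE bA) xX !sub1set aAx aA (subset_trans _ AX) ?subD1set //=.
    rewrite setSD // orbT /=; case: (leqP k) => // /eqk ->.
    by rewrite !orbT.
  - by have := subsetP AY x xA; rewrite !inE (negbTE xb) (negbTE xY).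
  - rewrite aA bA /=.
    (* The image still contains a, which lies outside b + Y, so it is not in the wing at b. *)
    have -> : (A :\ x \subset b |: Y) = false.
      apply/negbTE/negP => /subsetP/(_ a).
      by rewrite !inE eq_sym xa aA (negbTE ab) (negbTE aY) => /(_ isT).
    rewrite (eq_sym a) (eq_sym b) xa xb !orbT andbT /=.
    case: (leqP k) => // /eqk ->.
    rewrite subUset !sub1set aAx bAx aA bA subsetC sub1set !inE eqxx /=.
    by [].
have subD : D \subset F0.
  apply/subsetP=> A; rewrite !inE => /andP[wA ->]; rewrite wA !orbT /=.
  apply: contra xY => xA; case/andP: wA => _ /subsetP/(_ x xA).
  by rewrite !inE (negbTE xb).
(* Thus |F1| <= |F0| - |D| + |C1| + |C2|, and the binomial inequality gives |C1| + |C2| <= |D|. *)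
have := subset_leq_card sub1; rewrite card_in_imset // => le1.
have := leq_trans le1 (leq_card_setU _ _) => le2.
have := (leq_card_setU C1 C2).1; have := cardsD F0 D; rewrite (setIidPr subD).
have := subset_leq_card subD; have := card_D; have := card_C1; have := card_C2.
rewrite /binomial_ineq cXY in ineq *; rewrite /degree -/F1.
move: ineq le2; move: ((2 < k) * _) ((1 < k) * _) (\sum_(_ <= i < _) _).
move: #|F1| #|F0| #|D| #|C1| #|C2| #|C1 :|: C2| #|F0 :\: D|; clear; lia.
Qed.

End Infrequent.

End TwoBlocks.

Lemma subset_between (T : finType) (P Q : {set T}) m :
  P \subset Q -> #|P| <= m <= #|Q| ->
  exists A : {set T}, [/\ P \subset A, A \subset Q & #|A| = m].
Proof.
move=> PQ /andP[Pm mQ]; have := card_between (m - #|P|) PQ; rewrite subnKC //.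
move=> cB; have: 0 < 'C(#|Q| - #|P|, m - #|P|) by rewrite bin_gt0 leq_sub2r.
by rewrite -cB => /card_gt0P[A]; rewrite inE => /and3P[PA AQ /eqP]; exists A.
Qed.

(** * The two-block construction *)

Section TwoBlocksConstruction.

Variables (T : finType) (a b : T) (X Y : {set T}) (k : nat).
Hypotheses (ab : a != b) (aX : a \notin X) (bX : b \notin X).
Hypotheses (aY : a \notin Y) (bY : b \notin Y) (cXY : #|X| = #|Y|).
Hypotheses (leT : #|X|.*2.+2 <= #|T|) (lekX : k <= #|X|.+1).

Local Notation F := (two_blocks a b X Y k).

Lemma two_blocksU : union_closed F.
Proof.
move=> A B; rewrite !inE /wing => /andP[kA sA] /andP[_ sB].
rewrite (leq_trans kA) ?subset_leq_card ?subsetUl //= !inE.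
case/or4P: sA => [/eqP->|/andP[aA AX]|/andP[bA AY]|/andP[-> ->]];
case/or4P: sB => [/eqP->|/andP[aB BX]|/andP[bB BY]|/andP[-> ->]];
by rewrite ?setU0 ?set0U ?eqxx ?aA ?bA ?aB ?bB ?AX ?AY ?BX ?BY ?subUset ?AX ?AY
  ?BX ?BY ?inE ?aA ?bA ?aB ?bB ?orbT.
Qed.

Lemma two_blocks_setT : setT \in F.
Proof. by rewrite !inE cardsT !orbT andbT; move: leT lekX; clear; lia. Qed.

Lemma two_blocks_setC1 x : x != a -> x != b -> ~: [set x] \in F.
Proof.
move=> xa xb; rewrite !inE (eq_sym a) (eq_sym b) xa xb !orbT andbT cardsC1.
by move: leT lekX; clear; lia.
Qed.

Lemma two_blocks_wing : a |: X \in F.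
Proof.
by rewrite inE /wing setU11 subxx !orbT andbT cardsU1 aX.
Qed.

(** Adding a injects the sets avoiding a into those containing it, but not onto them. With at least
    three elements the full set is missed, as its complement of a is too large for the wing at b;
    otherwise {a} is missed, as the empty set is smaller than k. *)
Lemma two_blocks_frequentl : (2 < #|T|) || (0 < k) -> a \in frequent F.
Proof.
move=> T3; rewrite in_frequent.
have inj : {in [set A in F | a \notin A] &, injective (setU [set a])}.
  move=> A B; rewrite !inE => /andP[_ aA] /andP[_ aB] AB; apply/setP=> y.
  have /setP/(_ y) := AB; rewrite !inE.
  by case: eqVneq => //= ->; rewrite (negbTE aA) (negbTE aB).
rewrite -(card_in_imset inj); apply: proper_card; apply/properP; split.
  apply/subsetP=> _ /imsetP[A + ->]; rewrite !inE eqxx /wing.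
  case/andP=> /andP[kA sA] aA; rewrite (negbTE aA) /= orbF in sA *.
  rewrite (leq_trans kA) ?subset_leq_card ?subsetUr //= andbT.
  case/orP: sA => [/eqP->|/andP[-> _]]; last by rewrite orbT !orbT.
  by rewrite setU0 set11 sub1set setU11 !orbT.
case: (ltnP 2 #|T|) T3 => [T3 _|T2 /= k1].
  exists setT; first by rewrite inE two_blocks_setT inE.
  apply/negP=> /imsetP[A]; rewrite !inE /wing => /andP[/andP[_ sA] aA] TA.
  have AE y : (y \in A) = (y != a).
    by case: eqVneq => [->|ya]; [exact/negbTE | move/setP/(_ y): TA; rewrite !inE (negbTE ya)].
  have bA : b \in A by rewrite AE eq_sym.
  move: sA; rewrite (negbTE aA) bA /= orbF => /orP[/eqP A0|/subset_leq_card].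
    by rewrite A0 inE in bA.
  have -> : A = ~: [set a] by apply/setP=> y; rewrite AE !inE.
  by rewrite cardsC1 cardsU1 bY -cXY; move: leT T3; clear; lia.
exists [set a].
  rewrite !inE eqxx /wing cards1 set11 sub1set setU11 !orbT !andbT.
  by move: T2 leT lekX; clear; lia.
apply/negP=> /imsetP[A]; rewrite !inE => /andP[/andP[kA _] aA] aE.
have A0 : A = set0.
  apply/setP=> y; rewrite inE; apply/negbTE/negP => yA.
  by move/setP/(_ y): aE; rewrite !inE yA orbT => /eqP ya; rewrite -ya yA in aA.
by move: kA; rewrite A0 cards0 leqNgt k1.
Qed.

Lemma two_blocks_min_wing :
  exists2 A, A \in F & #|A| = k /\ A \subset a |: X.
Proof.
case: k lekX => [|m] lem.
  by exists set0; rewrite ?inE ?eqxx // cards0 sub0set.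
have [||A [aA AX cA]] := @subset_between _ [set a] (a |: X) m.+1.
- by rewrite sub1set setU11.
- by rewrite cards1 cardsU1 aX.
by exists A; rewrite // inE /wing cA leqnn -sub1set aA AX orbT.
Qed.

Lemma two_blocks_min_center :
  1 < k -> exists2 A, A \in F & #|A| = k /\ [set a; b] \subset A.
Proof.
move=> k1; have [||A [aA AX cA]] := @subset_between _ [set a; b] setT k.
- exact: subsetT.
- by rewrite cards2 ab k1 cardsT; move: leT lekX; clear; lia.
exists A => //; move: aA; rewrite subUset !sub1set => /andP[aA bA].
by rewrite inE cA leqnn aA bA !orbT.
Qed.

End TwoBlocksConstruction.

(** The blocks have size p, and o elements lie outside a, b and the blocks. For k = 0 and p = o = 0
    all subsets of {a, b} would occur, and a would lie in exactly half of them. The last two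
    conclusions supply the smallest sets used for multiplying and for adding copies. *)
Lemma two_blocks_construction k p o :
  k <= p.+1 -> (0 < k) || (0 < p + o) -> binomial_ineq (p.*2.+2 + o) p k ->
  exists (T : finType) (F : {set {set T}}),
    [/\ construction 2 k (p.*2.+2 + o) F, setT \in F, separating F,
        1 < k -> exists2 A, A \in F & #|A| = k /\ frequent F \subset A
      & 2 < p.*2.+2 + o -> exists2 A, A \in F &
          #|A| = k /\ exists2 x, x \notin A & x \notin frequent F].
Proof.
move=> lekp nz ineq.
pose T := (bool + (bool * 'I_p + 'I_o))%type.
pose a : T := inl true; pose b : T := inl false.
pose block c : {set T} := [set inr (inl (c, i)) | i in 'I_p].
have inbl c (z : T) : (z \in block c) = if z is inr (inl (d, _)) then d == c else false.
  apply/imsetP/idP => [[i _ ->] //|].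
  by case: z => // [[[d i]|]] // /eqP->; exists i.
have cbl c : #|block c| = p.
  by rewrite card_imset ?card_ord // => i j [].
have cT : #|{: T}| = p.*2.+2 + o.
  by rewrite !(card_sum, card_prod, card_bool, card_ord); lia.
have [aX bX aY bY] : [/\ a \notin block true, b \notin block true,
    a \notin block false & b \notin block false] by rewrite !inbl.
have ab : a != b by [].
have leT c : #|block c|.*2.+2 <= #|{: T}| by rewrite cbl cT leq_addr.
have lek c : k <= #|block c|.+1 by rewrite cbl.
have cXY : #|block true| = #|block false| by rewrite !cbl.
have T3 : (2 < #|{: T}|) || (0 < k) by rewrite cT; lia.
pose F := two_blocks a b (block true) (block false) k.
have FT : setT \in F by apply: two_blocks_setT.
have fr : frequent F = [set a; b].
  apply/setP=> x; rewrite in_setU !in_set1.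
  case: eqVneq => [->|xa]; first exact: two_blocks_frequentl.
  case: eqVneq => [->|xb] /=.
    by rewrite /F two_blocksC; apply: two_blocks_frequentl; rewrite ?(eq_sym b).
  (* [two_blocks_infrequent] wants x outside the second block, so the two sides are swapped if x
     lies in it. *)
  apply/negbTE; case xY: (x \in block false).
    rewrite /F two_blocksC; apply: two_blocks_infrequent; rewrite ?(eq_sym b) //.
      by move: xY; rewrite !inbl; case: x {xa xb} => // [[[d i]|]] // /eqP->.
    by rewrite cT cbl.
  by apply: two_blocks_infrequent; rewrite ?xY ?cT ?cbl.
exists T, F; split=> //.
- split; [exact: two_blocksU| by rewrite fr cards2 ab | split | ].
  + by have [A FA [cA _]] := two_blocks_min_wing b (block false) aX (lek true); exists A.
  + by move=> A; rewrite inE => /andP[].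
  + by rewrite -cT; apply: largest_size_setT.
- have wa : a |: block true \in F by apply: two_blocks_wing.
  have wb : b |: block false \in F.
    by rewrite /F two_blocksC; apply: two_blocks_wing.
  have C1 x : x != a -> x != b -> ~: [set x] \in F by apply: two_blocks_setC1.
  split=> [x|].
    case: (eqVneq x a) => [->|xa]; first by exists (b |: block false); rewrite // !inE.
    case: (eqVneq x b) => [->|xb]; first by exists (a |: block true); rewrite // !inE.
    by exists (~: [set x]); rewrite ?C1 // !inE eqxx.
  have sep x y : x != a -> x != b -> x != y -> exists2 A, A \in F & (x \in A) != (y \in A).
    by move=> xa xb xy; exists (~: [set x]); rewrite ?C1 // !inE eqxx (eq_sym y) xy.
  move=> x y xy; case: (boolP ((x == a) || (x == b))) => [xab|]; last first.
    by rewrite negb_or => /andP[xa xb]; apply: sep.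
  case: (boolP ((y == a) || (y == b))) => [yab|]; last first.
    rewrite negb_or => /andP[ya yb]; have [|A FA] := sep y x ya yb.
      by rewrite eq_sym.
    by exists A => //; rewrite eq_sym.
  exists (a |: block true) => //; rewrite !in_setU1.
  by case/orP: xab xy => /eqP->; case/orP: yab => /eqP->; rewrite ?eqxx ?(negbTE aX) ?(negbTE bX).
- by move=> k1; rewrite fr; apply: two_blocks_min_center.
- move=> n3; have [A FA [cA AX]] := two_blocks_min_wing b (block false) aX (lek true).
  exists A => //; split=> //.
  (* The right-hand side has at most p + 2 elements, fewer than 2p + 2 + o once there are three
     elements. *)
  have /subsetPn[x _] : ~~ (setT \subset b |: (a |: block true)).
    apply/negP=> /subset_leq_card; rewrite cardsT cT => le.
    have := leq_trans le (leq_card_setU _ _).1; rewrite cards1 cardsU1 aX cbl.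
    by move: n3; clear; lia.
  rewrite !in_setU1 !negb_or => /and3P[xb xa xX].
  exists x; last by rewrite fr !inE negb_or xa.
  by apply: contra xX => /(subsetP AX); rewrite in_setU1 (negbTE xa).
Qed.

(** * The binomial inequality over the integers and for large n *)

Lemma binomial_conditionP k n :
  (k, n) <> (0, 2) -> binomial_condition (Posz k) (Posz n) ->
  exists p o, [/\ n = p.*2.+2 + o, k <= p.+1, (0 < k) || (0 < p + o)
                & binomial_ineq n p k].
Proof.
rewrite /binomial_condition.
have -> : (Posz n %/ 2)%Z = Posz n./2 by rewrite divz_nat divn2.
move=> kn; case Dh: n./2 => [|p].
  (* For h = 0 every term has upper index -1 and vanishes, so the strict inequality fails. *)
  by rewrite /sumz; case: ifP => // _; rewrite big1 ?ltn0.
have -> : (Posz p.+1 - 1 = Posz p)%R by lia.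
rewrite /sumz; case: ifP => // lekp.
have {}lekp : k <= p.+1 by lia.
have Dn : n = p.*2.+2 + odd n by rewrite -doubleS -Dh addnC odd_double_half.
have -> : \sum_(0 <= j < (absz (Posz p - (Posz k - 1))%R).+1) binz p (Posz k - 1 + Posz j)%R
          = \sum_(k.-1 <= i < p.+1) 'C(p, i).
  (* For k = 0 the integer sum starts at i = -1, with a zero term, and the natural one at 0. *)
  case: k kn lekp => [|k] _ lekp.
    have -> : absz (Posz p - (Posz 0 - 1))%R = p.+1 by lia.
    rewrite big_ltn //= add0n -[1%N]addn1 big_addn subn1 /=.
    apply: eq_bigr => i _; by have -> : (0%Z - 1 + Posz (i + 1) = Posz i)%R by lia.
  have -> : absz (Posz p - (Posz k.+1 - 1))%R = p - k by lia.
  rewrite -subSn //= -[in RHS](add0n k) big_addn; apply: eq_bigr => i _.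
  by congr 'C(p, _); lia.
move=> ineq; exists p, (odd n : nat); split=> //.
  case: k kn lekp {ineq} => // kn _; case: p {Dh} Dn => // Dn.
  by case: (odd n) Dn => // Dn; case: kn; rewrite Dn.
apply: leq_trans (ltnW ineq); apply: leq_add.
  case: ltnP => // k2.
  have -> : (Posz n - 3)%R = Posz (n - 3) by lia.
  have -> : (Posz k - 3)%R = Posz (k - 3) by lia.
  by rewrite mul1n.
case: ltnP => // k1.
have -> : (Posz p.+1 - 2)%R = Posz (p - 1) by lia.
have -> : (Posz k - 2)%R = Posz (k - 2) by lia.
by rewrite mul1n.
Qed.

Lemma leq_sumz (a b i : int) (f : int -> nat) :
  (a <= i <= b)%R -> f i <= sumz a b f.
Proof.
move=> /andP[ai ib]; rewrite /sumz (Order.POrderTheory.le_trans ai ib).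
have -> : f i = f (a + Posz (absz (i - a)%R))%R by congr f; lia.
by rewrite big_mkord (bigD1 (inord (absz (i - a)%R))) //= inordK ?leq_addr //; lia.
Qed.

Lemma ffact_leq_exp n m : n ^_ m <= n ^ m.
Proof.
elim: m => // m IH; rewrite ffactnSr expnSr leq_mul ?leq_subr //.
Qed.

Lemma exp_leq_ffact n m : n ^ m <= (n + m) ^_ m.
Proof.
by elim: m => // m IH; rewrite addnS ffactSS expnS leq_mul // ltnW // ltnS leq_addr.
Qed.

Lemma binz_leq_exp (x y : int) (n k : nat) :
  0 < n -> (x <= Posz n)%R -> (y <= Posz k)%R -> binz x y <= n ^ k.
Proof.
move=> n0; case: x => x; case: y => y //=; rewrite !lez_nat => xn yk.
apply: (@leq_trans (x ^_ y)); first by rewrite -bin_ffact leq_pmulr ?fact_gt0.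
apply: leq_trans (ffact_leq_exp _ _) _.
by apply: leq_trans (leq_pexp2l n0 yk); case: y {yk} => // y; rewrite leq_exp2r.
Qed.

(** With h - 1 = q + k + 1, the right side times (k+1)! is at least q^(k+1), while n <= 3q bounds
    the left side times (k+1)! by 2 3^k (k+1)! q^k. *)
Lemma exp_ltn_bin k :
  exists N, forall n, N <= n -> 2 * n ^ k < 'C(n./2.-1, k.+1).
Proof.
(* The first bound on q yields n <= 3q, the second makes q exceed the constant factor. *)
pose Q := maxn (2 * k + 5) (2 * 3 ^ k * k.+1`!).+1.
exists (Q + k).+2.*2 => n leNn.
have leh : (Q + k).+2 <= n./2 by rewrite -(doubleK (Q + k).+2) half_leq.
pose q := n./2.-1 - k.+1; have Dh : n./2.-1 = q + k.+1 by rewrite /q; lia.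
have /andP[q1 q2] : (2 * k + 5 <= q) && (2 * 3 ^ k * k.+1`! < q).
  by rewrite -geq_max -/Q; lia.
have len : n <= 3 * q by have := odd_double_half n; case: (odd n); lia.
rewrite -(ltn_pmul2r (fact_gt0 k.+1)) bin_ffact Dh.
apply: leq_trans (exp_leq_ffact _ _); rewrite expnS.
apply: (@leq_ltn_trans (2 * 3 ^ k * k.+1`! * q ^ k)); last first.
  by rewrite ltn_pmul2r // expn_gt0; case: q q1 {q2 Dh len}; rewrite ?addnS.
have -> : 2 * 3 ^ k * k.+1`! * q ^ k = 2 * (3 * q) ^ k * k.+1`!.
  by rewrite expnMn mulnAC !mulnA.
rewrite leq_mul2r leq_mul2l; apply/orP; right; apply/orP; right.
by case: (k) => // j; rewrite leq_exp2r.
Qed.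

(** For k >= 0 the single term i = k + 1 of the sum exceeds both binomials on the other side, each
    at most n^k. For k < 0 those vanish and the term i = 0 is 1. *)
Lemma binomial_condition_eventually (k : int) :
  exists N : nat, forall n : nat, N <= n -> binomial_condition k (Posz n).
Proof.
case: k => k; last first.
  exists 2 => n n2; rewrite /binomial_condition divz_nat divn2.
  have -> (x : int) : binz x (Negz k - 3)%R = 0 by case: x.
  have -> (x : int) : binz x (Negz k - 2)%R = 0 by case: x.
  apply: (leq_trans _ (@leq_sumz _ _ (Posz 0) _ _)); last by lia.
  have -> : (Posz n./2 - 1)%R = Posz n./2.-1 by lia.
  by rewrite /= bin0.
have [N NP] := exp_ltn_bin k; exists (N + k.*2 + 6) => n leNn.
rewrite /binomial_condition divz_nat divn2.
have n0 : 0 < n by lia.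
apply: (leq_trans _ (@leq_sumz _ _ (Posz k.+1) _ _)); last by lia.
have -> : (Posz n./2 - 1)%R = Posz n./2.-1 by lia.
apply: (leq_trans _ (NP n _)); last by lia.
by rewrite ltnS mul2n -addnn leq_add // binz_leq_exp //; lia.
Qed.

(** * Adding and multiplying copies; the linear bounds *)

Lemma sum_indicator (T : finType) (A : {set T}) x c :
  \sum_(y in A) (y == x) * c = (x \in A) * c.
Proof.
case: (boolP (x \in A)) => xA.
  by rewrite (bigD1 x) //= eqxx big1 ?addn0 // => y /andP[_ /negbTE->].
by rewrite big1 // => y yA; case: eqVneq yA xA => // -> ->.
Qed.

(* p universal elements are adjoined, then the element x missed by a smallest
   set is replaced by e + 1 copies. *)
Lemma construction_extend (T : finType) (F : {set {set T}}) f k n A x :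
  setT \in F -> construction f k n F -> A \in F -> #|A| = k ->
  x \notin A -> x \notin frequent F ->
  forall p e, exists (T' : finType) (F' : {set {set T'}}),
    construction (p + f) (p + k) (p + n + e) F'.
Proof.
move=> FT [UF cf [_ minF] [[B FB cB] maxF]] FA cA xA xf p e.
have cT : #|T| = n.
  apply/eqP; rewrite eqn_leq -{2}cB max_card andbT -cardsT; exact: maxF.
(* The p copies of [None] are the universal elements; weight p = 0 deletes it, which is allowed
   since it lies in every set. *)
pose w (z : option T) := if z is Some y then 1 + (y == x) * e else p.
have sw (C : {set T}) : \sum_(z in adjoin C) w z = p + #|C| + (x \in C) * e.
  rewrite big_setU1 /=; last by case: imsetP => // [[]].
  rewrite big_imset /=; last by move=> ? ? _ _; apply: Some_inj.
  by rewrite big_split /= sum1_card sum_indicator addnA.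
exists _, (inflate_family (adjoin_family F) w).
apply: inflate_construction.
- by case=> // _ C /imsetP[D _ ->]; rewrite in_adjoin.
- exact: adjoin_union_closed.
- exact: adjoin_setT.
- by rewrite frequent_adjoin // sw cf (negbTE xf) addn0.
- by exists (adjoin A); rewrite ?imset_f // sw cA (negbTE xA) addn0.
- by move=> _ /imsetP[C FC ->]; rewrite sw -addnA leq_add2l (leq_trans (minF C FC)) ?leq_addr.
- have := sw setT; rewrite in_setT mul1n cardsT cT => <-.
  by apply: eq_bigl => z; rewrite in_adjoin; case: z => // y; rewrite inE.
Qed.

(* In a (2, 4, 12)-construction every infrequent element is replaced by m
   copies, except for one that lies in a smallest set and gets m - d copies,
   and one that lies outside this set and gets m + e copies. *)
Lemma construction_multiply m d e :
  d < m -> exists (T : finType) (F : {set {set T}}),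
    construction 2 (m.*2.+2 - d) (10 * m + 2 + e - d) F.
Proof.
move=> ltdm.
have [|||T [F [cF FT _ cen _]]] := @two_blocks_construction 4 5 0 => //.
  by rewrite /binomial_ineq unlock.
have {cF} : construction 2 4 12 F by [].
case=> UF cf [_ minF] [[B FB cB] maxF].
have cT : #|T| = 12.
  by apply/eqP; rewrite eqn_leq -{2}cB max_card andbT -cardsT; apply: maxF.
have [//|A FA [cA fA]] := cen.
have /subsetPn[y yA yf] : ~~ (A \subset frequent F).
  by apply/negP=> /subset_leq_card; rewrite cA cf.
have /subsetPn[x _ xA] : ~~ (setT \subset A).
  by apply/negP=> /subset_leq_card; rewrite cA cardsT cT.
have xf : x \notin frequent F by apply: contra xA; apply: (subsetP fA).
pose w z := if z \in frequent F then 1 else m + (z == x) * e - (z == y) * d.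
(* The additive form avoids truncated subtraction inside the sums. *)
have wE z : w z + (z == y) * d
            = (z \in frequent F) + (z \notin frequent F) * m + (z == x) * e.
  rewrite /w; case: (boolP (z \in frequent F)) => zf /=.
    have -> : (z == y) = false by apply: contraNF yf => /eqP<-.
    by have -> : (z == x) = false by apply: contraNF xf => /eqP<-.
  rewrite mul1n add0n subnK // (leq_trans _ (leq_addr _ _)) //.
  by case: (z == y); rewrite ?mul1n // ltnW.
have sw (C : {set T}) : \sum_(z in C) w z + (y \in C) * d
    = #|C :&: frequent F| + #|C :\: frequent F| * m + (x \in C) * e.
  rewrite -!sum_indicator -!big_split /= (eq_bigr _ (fun z _ => wE z)) /=.
  rewrite !big_split /= -big_distrl /=; congr (_ + _ * _ + _).
    rewrite -sum1_card big_mkcond [RHS]big_mkcond; apply: eq_bigr => z _.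
    by rewrite in_setI; case: (z \in C); case: (z \in frequent F).
  rewrite -sum1_card big_mkcond [RHS]big_mkcond; apply: eq_bigr => z _.
  by rewrite in_setD; case: (z \in C); case: (z \in frequent F).
exists _, (inflate_family F w); apply: inflate_construction => //.
- move=> z; rewrite /w; case: ifP => // _ /eqP; rewrite subn_eq0 leqNgt.
  rewrite (leq_trans _ (leq_addr _ _)) //.
  by case: (z == y); rewrite ?mul1n // (leq_ltn_trans _ ltdm).
- have := sw (frequent F); rewrite (negbTE yf) (negbTE xf) setIid setDv cards0 cf.
  by rewrite !mul0n !addn0.
- exists A => //; have := sw A; rewrite (setIidPr fA) cardsD (setIidPr fA).
  rewrite yA (negbTE xA) cA cf.
  by move: ltdm (\sum_(_ in A) w _); clear; lia.
- move=> C FC; have := sw C; have := minF C FC.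
  have := subset_leq_card (subsetIr C (frequent F)); rewrite cf.
  have := cardsID (frequent F) C.
  move: #|C :&: _| #|C :\: _| (\sum_(_ in C) _) => i j s <- i2 ij.
  (* A set with i <= 2 frequent elements has at least 4 - i others; without the corrections d and e
     its weight is at least i + (4 - i)m >= 2 + 2m, as m >= 1. *)
  have : (4 - i) * m <= j * m.
    by rewrite leq_mul2r orbC; move: ij s; clear; lia.
  move: (x \in C) (y \in C) ltdm i2; clear; case: i => [|[|[|//]]]; case; case; nia.
- have := sw setT; rewrite setTI setTD !in_setT cf !mul1n.
  have -> : \sum_(z in setT) w z = \sum_z w z by apply: eq_bigl => z; rewrite in_setT.
  have -> : #|~: frequent F| = 10 by apply/eqP; rewrite -(eqn_add2l 2) -{1}cf cardsC cT.
  by move: ltdm (\sum_z w z); clear; lia.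
Qed.

Lemma construction_two (k n : nat) :
  maxn 3 (5 * k - 4) <= n \/ ~~ odd k /\ maxn 3 (5 * k - 8) <= n ->
  exists (T : finType) (F : {set {set T}}), construction 2 k n F.
Proof.
have ext k0 p o : k0 <= p.+1 -> 0 < p + o -> binomial_ineq (p.*2.+2 + o) p k0 ->
    p.*2.+2 + o <= n -> 2 < p.*2.+2 + o ->
    exists (T : finType) (F : {set {set T}}), construction 2 k0 n F.
  move=> lek po ineq len n3.
  have [|||T [F [cF FT _ _ /(_ n3)[A FA [cA [x xA xf]]]]]] :=
    @two_blocks_construction k0 p o => //; first by rewrite po orbT.
  have := construction_extend FT cF FA cA xA xf 0 (n - (p.*2.+2 + o)).
  by rewrite !add0n subnKC.
(* For k <= 3 the seeds are (2, 0, 3)-, (2, 1, 3)-, (2, 2, 3)- and (2, 3, 8)-constructions. *)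
case: k => [|[|[|[|k]]]] leqn.
- by apply: (ext 0 0 1); rewrite // ?/binomial_ineq ?unlock //; lia.
- by apply: (ext 1 0 1); rewrite // ?/binomial_ineq ?unlock //; lia.
- have [FT cF] : setT \in bits_family 3 bits23 /\ construction 2 2 3 (bits_family 3 bits23).
    by apply: bits_construction; vm_compute.
  have F23 : bits_union_closed 3 bits23 by vm_compute.
  have FA : set_of_bits 3 [:: true; true; false] \in bits_family 3 bits23.
    by apply/bits_familyP; exists [:: true; true; false].
  have [|||T [F cF']] := construction_extend FT cF FA _ (x := ord_max) _ _ 0 (n - 3).
  + by rewrite card_set_of_bits.
  + by rewrite inE.
  + by rewrite frequent_bits // inE.
  by exists T, F; move: cF'; rewrite !add0n subnKC //; lia.
- by apply: (ext 3 3 0); rewrite // ?/binomial_ineq ?unlock //; lia.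
(* Let K = k + 4 be the required minimum size. Then 2m + 2 - d = K, and 10m + 2 - d is 5K - 8 for
   even K and 5K - 4 for odd K. *)
pose m := (k + 3)./2; pose d := nat_of_bool (odd k).
have Dk : k + 3 = m.*2 + (1 - d).
  by rewrite -(odd_double_half (k + 3)) oddD addnC /d; case: (odd k).
have ltdm : d < m by move: Dk; rewrite /d; case: (k) => [|j]; case: (odd _); lia.
have len : 10 * m + 2 - d <= n.
  move: leqn Dk; rewrite !geq_max /= negbK /d; case: (odd k) => /=.
    by case=> [/andP[_]|[]//]; lia.
  by case=> [|[_]] /andP[_]; lia.
have := construction_multiply (n - (10 * m + 2 - d)) ltdm.
have -> : m.*2.+2 - d = k.+4 by move: Dk ltdm; rewrite /d; case: (odd k); lia.
by have -> : 10 * m + 2 + (n - (10 * m + 2 - d)) - d = n by move: len ltdm; lia.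
Qed.

(** * Assembling the four claims *)

(** The set {0,..,4} misses the infrequent element 8, which can therefore be copied by
    [construction_extend]. *)
Lemma min459 : exists2 A, A \in bits_family 9 bits459 &
  #|A| = 5 /\ exists2 x, x \notin A & x \notin frequent (bits_family 9 bits459).
Proof.
have L9 : bits_union_closed 9 bits459 by vm_compute.
exists (set_of_bits 9 (nseq 5 true ++ nseq 4 false)).
  by apply/bits_familyP; exists (nseq 5 true ++ nseq 4 false).
split; first by rewrite card_set_of_bits.
exists ord_max; first by rewrite inE.
by rewrite (frequent_bits L9) inE; vm_compute.
Qed.

Lemma twin_free_adjoin (T : finType) (F : {set {set T}}) f k n :
  setT \in F -> construction f k n F -> separating F ->
  (exists (T' : finType) (F' : {set {set T'}}),
     construction f k n F' /\ twin_free F') /\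
  (exists (T' : finType) (F' : {set {set T'}}),
     construction f.+1 k.+1 n.+1 F' /\ twin_free F').
Proof.
move=> FT cF sepF; split; first by exists T, F; split=> //; apply/twin_free_sep/sepF.2.
exists _, (adjoin_family F); split; first exact: adjoin_construction.
exact: adjoin_twin_free.
Qed.

Theorem theorem2 :
  (* (1) *)
  ((exists (T : finType) (F : {set {set T}}),
      construction 2 3 8 F /\ twin_free F) /\
   (exists (T : finType) (F : {set {set T}}),
      construction 3 4 9 F /\ twin_free F) /\
   (exists (T : finType) (F : {set {set T}}),
      construction 4 5 9 F /\ twin_free F) /\
   (exists (T : finType) (F : {set {set T}}),
      construction 5 6 10 F /\ twin_free F)) /\
  (* (2); the pair (0, 2) satisfies the inequality, but there is no
     (2, 0, 2)-construction *)
  ((forall k n : nat,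
      (k, n) <> (0, 2) ->
      binomial_condition (Posz k) (Posz n) ->
      exists (T : finType) (F : {set {set T}}),
        construction 2 k n F /\ twin_free F) /\
   (forall k : int, exists N : nat, forall n : nat,
      N <= n -> binomial_condition k (Posz n))) /\
  (* (3) *)
  ((forall k n : nat,
      maxn 3 (5 * k - 4) <= n ->
      exists (T : finType) (F : {set {set T}}), construction 2 k n F) /\
   (forall k n : nat,
      ~~ odd k -> maxn 3 (5 * k - 8) <= n ->
      exists (T : finType) (F : {set {set T}}), construction 2 k n F)) /\
  (* (4) *)
  (forall k n : nat,
     3 <= k <= n - 4 -> 9 <= n ->
     exists (T : finType) (F : {set {set T}}), construction (k - 1) k n F).
Proof.
have [|||T8 [F8 [c8 T8F s8 _ /(_ isT)[A8 FA8 [cA8 [x8 xA8 xf8]]]]]] :=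
  @two_blocks_construction 3 3 0 => //.
  by rewrite /binomial_ineq unlock.
have {}c8 : construction 2 3 8 F8 by [].
have [T9F c9] := construction459.
have s9 : separating (bits_family 9 bits459).
  by apply: bits_separating; vm_compute.
have [e1 e2] := twin_free_adjoin T8F c8 s8.
have [e3 e4] := twin_free_adjoin T9F c9 s9.
split; first by [].
split; last split; last first.
- move=> k n /andP[k3 kn] n9.
  (* Adding k - 3 common elements to (2, 3, 8) gives (k-1, k, k+5), where k + 5 <= 9 <= n for k < 5.
     For larger k, adding k - 5 to (4, 5, 9) gives (k-1, k, k+4). Copies of an infrequent element
     fill up to n. *)
  case: (ltnP k 5) => k5.
    have [Dk Dn] : k - 3 + 2 = k - 1 /\ k - 3 + 8 + (n - (k + 5)) = n.
      by move: k3 k5 n9; clear; lia.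
    have := construction_extend T8F c8 FA8 cA8 xA8 xf8 (k - 3) (n - (k + 5)).
    by rewrite Dk Dn subnK.
  have [A9 FA9 [cA9 [x9 xA9 xf9]]] := min459.
  have [Dk Dn] : k - 5 + 4 = k - 1 /\ k - 5 + 9 + (n - (k + 4)) = n.
    by move: k5 kn n9; clear; lia.
  have := construction_extend T9F c9 FA9 cA9 xA9 xf9 (k - 5) (n - (k + 4)).
  by rewrite Dk Dn subnK.
- by split=> [k n kn|k n ek kn]; apply: construction_two; [left | right].
split; last exact: binomial_condition_eventually.
move=> k n kn /(binomial_conditionP kn)[p [o [-> lekp nz ineq]]].
have [T [F [cF _ sepF _ _]]] := two_blocks_construction lekp nz ineq.
by exists T, F; split=> //; apply/twin_free_sep/sepF.2.
Qed.
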